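(* Let $m$ be an odd positive integer and let $W=(w_{-r},\ldots,w_r)\in\mathbb{Z}^{2r+1}$ be the weight sequence of a one-dimensional additive cellular automaton such that $\sigma=-2\sigma'$ and $\sigma$ is invertible modulo $m$. Let $a,d\in\mathbb{Z}/m\mathbb{Z}$ with $d$ invertible. Then, in the orbit $\mathcal{O}(\mathrm{AP}(a,d))$, every $(0,1)$-antisymmetric triangle of orientation $(-1,1)$ or $(1,-1)$ and of size $s$ is balanced, for all positive integers $s\equiv 0$ or $-1\pmod{\mathrm{lcm}(\mathrm{pord}_m(\sigma),m)}$.
   Context: The ACA with weights $W$ maps a sequence $(a_i)_{i\in\mathbb{Z}}$ of $\mathbb{Z}/m\mathbb{Z}$ to $\left(\sum_{j=-r}^{r}w_ja_{i+j}\right)_{i\in\mathbb{Z}}$; $\sigma=\sum_jw_j$, $\sigma'=\sum_j jw_j$. $\mathrm{AP}(a,d)=(a+id)_{i\in\mathbb{Z}}$. The orbit is the array $(a_{i,j})_{(i,j)\in\mathbb{Z}\times\mathbb{N}}$ whose $j$-th row is $\partial^j(\mathrm{AP}(a,d))$. The triangle with principal vertex $j\in\mathbb{Z}\times\mathbb{N}$, orientation $\varepsilon\in\{-1,1\}^2$ and size $s$ is the multiset $\{a_{j+\varepsilon\cdot k}: k\in\mathbb{N}^2,\ k_1+k_2\le s-1\}$ ($\varepsilon\cdot k=(\varepsilon_1k_1,\varepsilon_2k_2)$, indices in $\mathbb{Z}\times\mathbb{N}$). It is $(0,1)$-antisymmetric if $a_{j+\varepsilon\cdot k}+a_{j+\varepsilon\cdot(s-1-k_1-k_2,\,k_2)}=0$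 for all $k\in\mathbb{N}^2$ with $k_1+k_2\le s-1$. Balanced means every element of $\mathbb{Z}/m\mathbb{Z}$ occurs with the same multiplicity. $\mathrm{pord}_m(\sigma)$ is the multiplicative order of $\sigma$ in $(\mathbb{Z}/m\mathbb{Z})^*/\{-1,1\}$, i.e. the least $k\ge1$ with $\sigma^k\equiv\pm1\pmod m$. *)

(* Defs.v *)
From mathcomp Require Import all_boot all_order all_algebra all_fingroup all_solvable.

Set Implicit Arguments.
Unset Strict Implicit.
Unset Printing Implicit Defensive.

Import GRing.Theory.
Local Open Scope ring_scope.

(* The additive group Z/mZ for m > 0. The library's 'Z_m is not used because
   it denotes Z/2Z when m = 1. For general m > 0 only the group structure is
   canonical; the product and unit are Zp_mul and Zp1. *)
Notation Zmod m := 'I_(m.-1.+1).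

Definition Zmod_invertible (m : nat) (x : Zmod m) : Prop :=
  exists y : Zmod m, Zp_mul x y = Zp1.

Definition invertible_mod (m : nat) (x : int) : Prop :=
  exists y : int, (x * y = 1 %[mod m])%Z.

Section ACA.
Variables (r : nat) (W : (r.*2.+1).-tuple int).

(* W = (w_{-r}, ..., w_r): position k of the tuple holds w_{k - r}. *)
Definition offset (k : 'I_(r.*2.+1)) : int := k%:Z - r%:Z.

Definition sigma : int := \sum_k tnth W k.

Definition sigma' : int := \sum_k offset k * tnth W k.

Definition aca (V : zmodType) (u : int -> V) : int -> V :=
  fun i => \sum_k u (i + offset k) *~ tnth W k.

Definition aca_orbit (V : zmodType) (u : int -> V) : int -> nat -> V :=
  fun i j => iter j (@aca V) u i.

End ACA.

Definition AP (V : zmodType) (a d : V) : int -> V := fun i => a + d *~ i.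

Section Triangles.
Variables (V : zmodType) (A : int -> nat -> V).
Variables (j : int * nat) (e : int * int) (s : nat).

(* All the positions j + e.k of the triangle have a nonnegative row index. *)
Definition triangle_in_array : Prop :=
  forall k : nat * nat, (k.1 + k.2 <= s.-1)%N -> 0 <= j.2%:Z + e.2 * k.2%:Z.

(* a_{j + e.k}; the absolute value only converts the row index to nat, it is
   meaningful under triangle_in_array. *)
Definition triangle_entry (k : nat * nat) : V :=
  A (j.1 + e.1 * k.1%:Z) (absz (j.2%:Z + e.2 * k.2%:Z)).

(* The multiset of the entries with k.1 + k.2 <= s - 1, as a sequence (only
   multiplicities matter). *)
Definition triangle : seq V :=
  [seq triangle_entry (k1, k2) | k2 <- iota 0 s, k1 <- iota 0 (s - k2)].

Definition antisymmetric01 : Prop :=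
  forall k : nat * nat, (k.1 + k.2 <= s.-1)%N ->
    triangle_entry k + triangle_entry ((s.-1 - k.1 - k.2)%N, k.2) = 0.

End Triangles.

Definition balanced (T : eqType) (M : seq T) : Prop :=
  forall x y : T, count_mem x M = count_mem y M.

Definition eq_pm1_mod (m : nat) (x : int) : bool :=
  (x == 1 %[mod m])%Z || (x == -1 %[mod m])%Z.

(* The least k >= 1 with x ^ k = 1 or -1 modulo m. Searching up to m suffices
   for x invertible modulo m, see pordP. *)
Definition pord (m : nat) (x : int) : nat :=
  (find (fun k => eq_pm1_mod m (x ^+ k)) (iota 1 m)).+1.

Lemma pordP (m : nat) (x : int) : (0 < m)%N -> invertible_mod m x ->
  eq_pm1_mod m (x ^+ pord m x) /\
  (forall k, (0 < k)%N -> eq_pm1_mod m (x ^+ k) -> (pord m x <= k)%N).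
Proof.
move=> m_gt0 [y xy1].
have cop : coprime `|(x %% m)%Z| m.
  have /coprimezP : exists uv, uv.1 * (x %% m)%Z + uv.2 * m%:Z = 1.
    exists (y, ((1 - (x %% m)%Z * y) %/ m)%Z) => /=.
    rewrite divzK ?[y * _]mulrC ?subrKC //.
    by rewrite -eqz_mod_dvd modzMml xy1.
  by rewrite coprimezE.
have tot_le : (totient m <= m)%N.
  rewrite totient_count_coprime big_mkord -[leqRHS]muln1.
  rewrite -[X in (_ <= X * 1)%N]card_ord -sum_nat_const.
  by apply: leq_sum => i _; apply: leq_b1.
have Etot : eq_pm1_mod m (x ^+ totient m).
  apply/orP; left; apply/eqP; rewrite -modzXm.
  have -> : (x %% m)%Z = `|(x %% m)%Z|%N :> int.
    by rewrite gez0_abs // modz_ge0 // eqz_nat -lt0n.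
  by rewrite -rmorphXn /= natrXE !modz_nat Euler_exp_totient.
set P := fun k => eq_pm1_mod m (x ^+ k).
have hasP : has P (iota 1 m).
  apply/hasP; exists (totient m) => //.
  by rewrite mem_iota totient_gt0 m_gt0 add1n ltnS.
split.
  have := nth_find 0 hasP; rewrite nth_iota ?add1n //.
  by rewrite -[ltnRHS](size_iota 1) -has_find.
move=> [//|k] _ Pk; rewrite /pord ltnS leqNgt; apply/negP => lt_k.
have := before_find 0 lt_k; rewrite nth_iota ?add1n ?Pk //.
by apply: leq_trans lt_k _; rewrite -[leqRHS](size_iota 1) find_size.
Qed.

(* Main.v *)
(**
Since [sigma = - 2 * sigma'], the orbit satisfies
[2 a_{i,j} = sigma^j (2 a + (2 i - j) d)], and antisymmetry says exactly that
[2 a + (2 i - j) d] vanishes at the middle of the rows of the triangle. Hence,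
up to a unit, the row of length [l] of the triangle is the progression
[l - 1, l - 3, ..., - (l - 1)] multiplied by [u^l], with [u] equal to [sigma]
or to its inverse. It remains to see that, when [m] divides [L] and
[u^L = 1] or [-1] modulo [m], the rows of lengths [0 <= l < L] have together a
constant multiplicity function; this goes by strong induction on [m], see
[sum_row_count_const].
*)
Require Import Defs.
From mathcomp Require Import all_boot all_order all_algebra all_fingroup.
From mathcomp Require Import all_solvable ring.

Set Implicit Arguments.
Unset Strict Implicit.
Unset Printing Implicit Defensive.

Import Order.TTheory GRing.Theory Num.Theory.
Local Open Scope ring_scope.

(** * Linear congruences over a full period *)

Lemma eq_dvdz (m x y : int) : (m %| x - y)%Z -> (m %| x)%Z = (m %| y)%Z.
Proof. by move=> dxy; rewrite -(subrK y x) rpredDl. Qed.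

Lemma sum_periodic_shift (f : int -> nat) (q : nat) (z : int) :
    (forall x, f (x + q%:Z) = f x) ->
  (\sum_(t < q) f (t%:Z + z)%R = \sum_(t < q) f t%:Z)%N.
Proof.
move=> fq.
have step y : (\sum_(t < q) f (t%:Z + (y + 1))%R = \sum_(t < q) f (t%:Z + y)%R)%N.
  case: q fq => [|q] fq; first by rewrite !big_ord0.
  rewrite big_ord_recr big_ord_recl /= addnC; congr (_ + _)%N.
    by rewrite add0r -(fq y); congr f; ring.
  by apply: eq_bigr => i _; congr f; rewrite /bump /=; ring.
elim/int_ind: z => [|n IHn|n IHn].
- by apply: eq_bigr => i _; rewrite addr0.
- by rewrite -IHn -(step n); apply: eq_bigr => i _; congr f; ring.
- by rewrite -IHn -(step (- n.+1%:Z)); apply: eq_bigr => i _; congr f; ring.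
Qed.

(** A solution forces [gcdn p m] to divide [z]. Conversely Bezout writes such a [z] as a multiple of
    [p] modulo [m], so adding [z] only translates [t], and [m %| p * q] makes the condition
    [q]-periodic in [t]. *)
Lemma sum_dvdz_progression (m p q : nat) (z : int) : (m %| p * q)%N ->
  (\sum_(t < q) (m %| (p%:Z * t%:Z + z)%R)%Z =
   (\sum_(t < q) (m %| (p%:Z * t%:Z)%R)%Z) * (gcdn p m %| z)%Z)%N.
Proof.
move=> dpq; have [gz|ngz] := boolP (gcdn p m %| z)%Z; last first.
  rewrite muln0 big1 // => t _.
  case: (boolP (m %| _)%Z) => // dz; case/negP: ngz.
  have dpt : (gcdn p m %| p%:Z * t%:Z)%Z.
    by rewrite dvdz_mulr // dvdzE /= dvdn_gcdl.
  rewrite -(rpredDl z dpt); apply: dvdz_trans dz.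
  by rewrite dvdzE /= dvdn_gcdr.
rewrite muln1; case/dvdzP: gz => c ->.
have [u [v Euv]] := Bezoutz p m.
have -> : (gcdn p m)%:Z = u * p%:Z + v * m%:Z by rewrite Euv.
pose f (x : int) : nat := (m%:Z %| p%:Z * x)%Z.
rewrite -(@sum_periodic_shift f q (c * u)) => [|x].
  apply: eq_bigr => t _; congr (nat_of_bool _); apply: eq_dvdz.
  by apply/dvdzP; exists (c * v); ring.
congr (nat_of_bool _); apply: eq_dvdz.
by rewrite mulrDr addrAC subrr add0r -PoszM dvdzE.
Qed.

Lemma sum_dvdz_step2 (m n : nat) (z : int) : odd m -> (m %| n)%N ->
  (\sum_(k < n) (m %| (z - 2 * k%:Z)%R)%Z = \sum_(k < n) (m %| (2 * k%:Z)%R)%Z)%N.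
Proof.
move=> m_odd dn.
have E : (gcdn 2 m = 1)%N by apply/eqP; rewrite -/(coprime 2 m) coprime2n.
have := @sum_dvdz_progression m 2 n (- z) (dvdn_mull _ dn).
rewrite E dvdzE /= dvd1n muln1 => <-; apply: eq_bigr => k _.
by congr (nat_of_bool _); rewrite -rpredN opprB.
Qed.

(** * Multiplicities in one row *)

(* The multiplicity of [y] modulo [m] in the progression
   [l - 1, l - 3, ..., - (l - 1)] of length [l]. *)
Definition row_count (m l : nat) (y : int) : nat :=
  (\sum_(k < l) (m %| (l%:Z - 1 - 2 * k%:Z - y)%R)%Z)%N.

Lemma row_count_mod (m l : nat) (x y : int) :
  (m %| x - y)%Z -> row_count m l x = row_count m l y.
Proof.
move=> dxy; apply: eq_bigr => k _; congr (nat_of_bool _); apply: eq_dvdz.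
by rewrite -rpredN [X in (_ %| X)%Z](_ : _ = x - y) //; ring.
Qed.

Lemma row_countN m l y : row_count m l (- y) = row_count m l y.
Proof.
rewrite /row_count (reindex_inj rev_ord_inj); apply: eq_bigr => k _ /=.
by rewrite -[in RHS]rpredN -subzn //; congr (nat_of_bool (_ %| _)%Z); ring.
Qed.

Lemma row_count_pm1 m l x y :
  eq_pm1_mod m x -> row_count m l (x * y) = row_count m l y.
Proof.
case/orP; rewrite eqz_mod_dvd => /dvdzP[c Ec].
  by apply: row_count_mod; apply/dvdzP; exists (c * y); rewrite mulrAC -Ec; ring.
rewrite -[RHS]row_countN; apply: row_count_mod.
by apply/dvdzP; exists (c * y); rewrite mulrAC -Ec; ring.
Qed.

Lemma row_countD m l n y :
  row_count m (l + n) y =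
  (\sum_(k < l) (m %| ((l + n)%:Z - 1 - 2 * k%:Z - y)%R)%Z
   + row_count m n (y + l%:Z)%R)%N.
Proof.
rewrite /row_count big_split_ord /=; congr (_ + _)%N.
by apply: eq_bigr => k _; congr (nat_of_bool (_ %| _)%Z); ring.
Qed.

Lemma row_count_full m n y : odd m -> (m %| n)%N ->
  row_count m n y = (\sum_(k < n) (m %| (2 * k%:Z)%R)%Z)%N.
Proof.
move=> m_odd dn; rewrite -(sum_dvdz_step2 (n%:Z - 1 - y) m_odd dn).
by apply: eq_bigr => k _; congr (nat_of_bool (_ %| _)%Z); ring.
Qed.

(** Modulo [a + b], the term after [- (a - 1)] in steps of -2 is [- a - 1], congruent to [b - 1]:
    the two rows join into a single progression of length [a + b], which runs over full periods. *)
Lemma row_count_compl m a b y : odd m -> (m %| a + b)%N ->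
  (row_count m a y + row_count m b y = \sum_(k < a + b) (m %| (2 * k%:Z)%R)%Z)%N.
Proof.
move=> m_odd dab; rewrite -(sum_dvdz_step2 (a%:Z - 1 - y) m_odd dab).
rewrite big_split_ord /=; congr (_ + _)%N.
  by apply: eq_bigr => k _; congr (nat_of_bool (_ %| _)%Z); ring.
apply: eq_bigr => k _; congr (nat_of_bool _); apply: eq_dvdz.
by rewrite [X in (_ %| X)%Z](_ : _ = (a + b)%:Z) ?dvdzE //; ring.
Qed.

Lemma sum_row_count_multiples m p q x y : odd m -> (m %| p * q)%N ->
  (\sum_(t < q) row_count m (p * t) x = \sum_(t < q) row_count m (p * t) y)%N.
Proof.
move=> m_odd dpq; apply/eqP.
(* The range is extended to [t = q], a row of full periods, so that [t] can be paired with [q - t]: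
   the lengths [p * t] and [p * (q - t)] are complementary. *)
suff {x y} C x : (\sum_(t < q.+1) row_count m (p * t) x).*2 =
    (\sum_(t < q.+1) \sum_(k < p * q) (m %| (2 * k%:Z)%R)%Z)%N.
  have /eqP := etrans (C x) (esym (C y)).
  by rewrite -!muln2 eqn_pmul2r // !big_ord_recr /= !row_count_full // eqn_add2r.
rewrite -addnn {2}(reindex_inj rev_ord_inj) -big_split; apply: eq_bigr => t _ /=.
have E : (p * t + p * (q - t) = p * q)%N by rewrite -mulnDr subnKC // -ltnS.
by rewrite subSS row_count_compl ?E.
Qed.

Lemma big_ord_mul (p q : nat) (F : nat -> nat) :
  (\sum_(l < p * q) F l = \sum_(i < p) \sum_(t < q) F (i + p * t))%N.
Proof.
rewrite exchange_big /= mulnC -(big_mkord xpredT) big_nat_mul big_mkord.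
apply: eq_bigr => t _.
rewrite -{1}[(t * p)%N]add0n mulSn big_addn addnK big_mkord.
by apply: eq_bigr => i _; rewrite mulnC.
Qed.

(** * Powers congruent to 1 or -1, and the sum over row lengths *)

Lemma eq_pm1_modX m x n : eq_pm1_mod m x -> eq_pm1_mod m (x ^+ n).
Proof.
case/orP=> /eqP E; rewrite /eq_pm1_mod -modzXm E modzXm ?expr1n ?eqxx //.
by rewrite -signr_odd; case: (odd n); rewrite eqxx ?orbT.
Qed.

Lemma dvd_eq_pm1_mod (m n : nat) x :
  (n %| m)%N -> eq_pm1_mod m x -> eq_pm1_mod n x.
Proof.
move=> nm; rewrite /eq_pm1_mod !eqz_mod_dvd.
by case/orP=> /(@dvdz_trans m n _ nm) ->; rewrite ?orbT.
Qed.

Lemma Euler_exp_totientz (m : nat) (u : int) : (0 < m)%N -> coprimez u m ->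
  (u ^+ totient m = 1 %[mod m])%Z.
Proof.
move=> m_gt0 cop; rewrite -modzXm.
have E : (u %% m)%Z = `|(u %% m)%Z|%N :> int.
  by rewrite gez0_abs // modz_ge0 // eqz_nat -lt0n.
have copm : coprime `|(u %% m)%Z| m.
  by have := cop; rewrite /coprimez -gcdz_modl.
by rewrite E -rmorphXn /= natrXE !modz_nat Euler_exp_totient.
Qed.

Lemma totient_lt (m : nat) : (1 < m)%N -> (totient m < m)%N.
Proof.
case: m => [|[|m]] // _; rewrite totient_count_coprime big_nat_recl //.
rewrite /coprime gcdn0 /= add0n ltnS big_mkord -[leqRHS]card_ord -sum1_card.
by apply: leq_sum => i _; apply: leq_b1.
Qed.

(** By Bezout the gcd is a multiple of [L] minus a multiple of [totient m], and the latter
    contributes a factor 1 by Euler. *)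
Lemma eq_pm1_mod_gcd (m L : nat) (u : int) :
    (0 < m)%N -> (0 < L)%N -> coprimez u m -> eq_pm1_mod m (u ^+ L) ->
  eq_pm1_mod m (u ^+ gcdn L (totient m)).
Proof.
move=> m_gt0 L_gt0 cop uL; case: (egcdnP (totient m) L_gt0) => a b E _.
have := eq_pm1_modX a uL; rewrite -exprM mulnC E exprD mulnC exprM.
rewrite /eq_pm1_mod -modzMml -[X in (X * _)%R]modzXm Euler_exp_totientz //.
by rewrite modzXm expr1n modzMml mul1r.
Qed.

(* Splitting [l = i + p * t] with [u ^ p = ±1 mod m], the sum over [t] only
   depends on [y] modulo [g = gcd p m], up to a constant; this reduces the
   claim for [m] and [L] to the claim for [g] and [p]. Taking [p] below
   [totient m] makes [g] smaller than [m]. *)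
Lemma sum_row_count_const (m L : nat) (u y : int) :
    odd m -> (m %| L)%N -> coprimez u m -> eq_pm1_mod m (u ^+ L) ->
  (\sum_(l < L) row_count m l (u ^+ l * y)%R = \sum_(l < L) row_count m l 0)%N.
Proof.
have [n] := ubnP m; elim: n => // n IHn in m L y * => /ltnSE le_mn.
move=> m_odd dL cop uL; have m_gt0 := odd_gt0 m_odd.
have [->|L_gt0] := posnP L; first by rewrite !big_ord0.
have [m1|m_gt1] := leqP m 1.
  have {m1 m_gt0} m1 : m = 1%N by apply/eqP; rewrite eqn_leq m1.
  by apply: eq_bigr => l _; apply: row_count_mod; rewrite m1 dvdzE /= dvd1n.
pose p := gcdn L (totient m); pose g := gcdn p m.
have up : eq_pm1_mod m (u ^+ p) by apply: eq_pm1_mod_gcd.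
have p_lt : (p < m)%N.
  apply: leq_ltn_trans (totient_lt m_gt1).
  by rewrite dvdn_leq ?totient_gt0 // dvdn_gcdr.
have p_gt0 : (0 < p)%N by rewrite gcdn_gt0 L_gt0.
have g_lt : (g < n)%N.
  apply: leq_trans le_mn; apply: leq_ltn_trans p_lt.
  by rewrite dvdn_leq // dvdn_gcdl.
have /dvdnP[q Lpq] : (p %| L)%N by apply: dvdn_gcdl.
rewrite mulnC in Lpq; have dpq : (m %| p * q)%N by rewrite -Lpq.
(* The first [i] terms of each row, summed over [t], are handled by [sum_dvdz_progression] and
   become a row modulo [g]. The remaining [p * t] terms form a translated row, whose sum over [t]
   does not depend on the translation. *)
have row_i i z : (\sum_(t < q) row_count m (i + p * t) z =
    (\sum_(t < q) (m %| (p%:Z * t%:Z)%R)%Z) * row_count g i z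
    + \sum_(t < q) row_count m (p * t) 0)%N.
  under eq_bigr do rewrite row_countD.
  rewrite big_split /= (@sum_row_count_multiples m p q _ 0) //.
  congr (_ + _)%N; rewrite exchange_big /= /row_count big_distrr /=.
  apply: eq_bigr => k _; rewrite -sum_dvdz_progression //.
  by apply: eq_bigr => t _; congr (nat_of_bool (_ %| _)%Z); ring.
have reduce z : (\sum_(l < L) row_count m l (u ^+ l * z)%R =
    (\sum_(t < q) (m %| (p%:Z * t%:Z)%R)%Z) * \sum_(i < p) row_count g i (u ^+ i * z)%R
    + p * \sum_(t < q) row_count m (p * t) 0)%N.
  rewrite Lpq (big_ord_mul p q (fun l => row_count m l (u ^+ l * z)%R)).
  transitivity (\sum_(i < p) \sum_(t < q) row_count m (i + p * t) (u ^+ i * z)%R)%N.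
    apply: eq_bigr => i _; apply: eq_bigr => t _.
    (* The factor [u ^+ (p * t)] is 1 or -1 modulo [m], and rows are symmetric under negation. *)
    rewrite addnC exprD -mulrA row_count_pm1 ?exprM //.
    exact: eq_pm1_modX.
  under eq_bigr do rewrite row_i.
  by rewrite big_split /= -big_distrr sum_nat_const card_ord.
have IH z : (\sum_(i < p) row_count g i (u ^+ i * z)%R =
    \sum_(i < p) row_count g i 0)%N.
  have gm : (g %| m)%N by apply: dvdn_gcdr.
  apply: IHn => //.
  - by rewrite (dvdn_odd gm).
  - exact: dvdn_gcdl.
  - exact: coprimez_dvdr gm cop.
  - exact: dvd_eq_pm1_mod up.
rewrite reduce IH -(IH 0) -reduce; apply: eq_bigr => l _.
by rewrite mulr0.
Qed.
Lemma sum_rows_const (m s : nat) (u x y : int) :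
    odd m -> coprimez u m ->
    (exists2 L, L \in [:: s; s.+1] & (m %| L)%N && eq_pm1_mod m (u ^+ L)) ->
  (\sum_(k < s) row_count m (s - k) (u ^+ (s - k) * x)%R =
   \sum_(k < s) row_count m (s - k) (u ^+ (s - k) * y)%R)%N.
Proof.
move=> m_odd cop [L Ls /andP[dL uL]].
(* An empty row is added to get the lengths 0 to [s]. If [L = s], the extra row of length [s]
   consists of full periods and contributes the last term. *)
suff E z : (\sum_(k < s) row_count m (s - k) (u ^+ (s - k) * z)%R =
    \sum_(l < L) row_count m l 0
    + (L == s) * \sum_(k < s) (m %| (2 * k%:Z)%R)%Z)%N by rewrite !E.
have -> : (\sum_(k < s) row_count m (s - k) (u ^+ (s - k) * z)%R =
    \sum_(l < s.+1) row_count m l (u ^+ l * z)%R)%N.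
  rewrite big_ord_recl /= {2}/row_count big_ord0 add0n.
  by rewrite (reindex_inj rev_ord_inj); apply: eq_bigr => k _ /=; rewrite subKn.
move: Ls; rewrite !inE => /orP[]/eqP EL; rewrite EL in dL uL *.
  by rewrite eqxx mul1n big_ord_recr /= sum_row_count_const // row_count_full.
by rewrite gtn_eqF // mul0n addn0 sum_row_count_const.
Qed.

(** * Integer representatives, the orbit and its triangles *)

Lemma Zp1_mulz_eq0 (m : nat) (x : int) : (0 < m)%N ->
  ((Zp1 : Zmod m) *~ x == 0) = (m %| x)%Z.
Proof.
move=> m_gt0; have Enat n : ((Zp1 : Zmod m) *+ n == 0) = (m %| n)%N.
  by rewrite Zp_mulrn -val_eqE /= modnMml mul1n prednK.
by case: x => n; rewrite ?NegzE ?mulrNz ?oppr_eq0 -pmulrn Enat dvdzE.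
Qed.

Lemma eq_Zp1_mulz (m : nat) (x y : int) : (0 < m)%N ->
  ((Zp1 : Zmod m) *~ x == Zp1 *~ y) = (m %| x - y)%Z.
Proof. by move=> m_gt0; rewrite -subr_eq0 -mulrzBr Zp1_mulz_eq0. Qed.

Lemma Zp1_mulz_val (m : nat) (x : Zmod m) : Zp1 *~ x%:Z = x.
Proof.
by rewrite -pmulrn Zp_mulrn; apply: val_inj; rewrite /= modnMml mul1n modn_small.
Qed.

(** One step multiplies by [sigma W] and adds [2 * d * sigma' W], that is [- d * sigma W], which
    turns [j] into [j + 1]. Doubling avoids a division by 2. *)
Lemma aca_orbit_AP (r : nat) (W : (r.*2.+1).-tuple int) (V : zmodType) (g : V)
    (a d i : int) (j : nat) :
    sigma W = - 2 * sigma' W ->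
  aca_orbit W (AP (g *~ a) (g *~ d)) i j *~ 2 =
  g *~ (sigma W ^+ j * (2 * a + (2 * i - j%:Z) * d)).
Proof.
move=> sigmaE; elim: j i => [|j IHj] i.
  by rewrite /aca_orbit /= /AP -mulrzA -mulrzDr -mulrzA; congr (_ *~ _); ring.
rewrite /aca_orbit iterS /aca mulrz_suml.
under eq_bigr => k _ do
  rewrite mulrzAC -[iter _ _ _ _]/(aca_orbit _ _ _ _) IHj -mulrzA.
rewrite -mulrz_sumr exprS; congr (_ *~ _); move: (sigma W ^+ j) => z.
transitivity (z * ((2 * a + (2 * i - j%:Z) * d) * sigma W
    + 2 * d * sigma' W)); last by rewrite sigmaE; ring.
rewrite /sigma /sigma' !mulr_sumr -big_split mulr_sumr; apply: eq_bigr => k _.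
by rewrite /=; ring.
Qed.

Lemma balanced_of_rows (m s : nat) (A : int -> nat -> Zmod m)
    (j : int * nat) (e : int * int) (u c : int) :
    odd m -> coprimez u m ->
    (exists2 L, L \in [:: s; s.+1] & (m %| L)%N && eq_pm1_mod m (u ^+ L)) ->
    (forall (X : int) (k1 k2 : nat), (k1 + k2 < s)%N ->
       (triangle_entry A j e (k1, k2) == Zp1 *~ X) =
       (m %| (s - k2)%N%:Z - 1 - 2 * k1%:Z - u ^+ (s - k2) * (c * X))%Z) ->
  balanced (triangle A j e s).
Proof.
move=> m_odd cop exL entryE.
suff E x : count_mem x (triangle A j e s) =
    (\sum_(k < s) row_count m (s - k) (u ^+ (s - k) * (c * x%:Z))%R)%N.
  by move=> x y; rewrite !E; apply: sum_rows_const.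
have iotaE n : iota 0 n = index_iota 0 n by rewrite /index_iota subn0.
rewrite -sum1_count big_mkcond big_allpairs_dep iotaE big_mkord.
apply: eq_bigr => k2 _; rewrite iotaE big_mkord.
apply: eq_bigr => k1 _; rewrite -{1}(Zp1_mulz_val x) inE /= entryE.
  by case: dvdz.
by rewrite addnC -ltn_subRL.
Qed.

(** * Inverses modulo [m] and the two orientations *)

Lemma coprimez_inv (m s t : int) : (m %| s * t - 1)%Z -> coprimez s m.
Proof.
case/dvdzP=> c E; apply/coprimezP; exists (t, - c) => /=.
by rewrite mulNr -E; ring.
Qed.

Lemma dvdz_mul_inv (m s t x y : int) :
  (m %| s * t - 1)%Z -> (m %| s * x - y)%Z = (m %| x - t * y)%Z.
Proof.
move=> st1; have cop : coprimez m t.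
  by rewrite coprimez_sym (@coprimez_inv _ _ s) // mulrC.
case/dvdzP: st1 => c E; rewrite -(Gauss_dvdzr _ cop); apply: eq_dvdz.
by apply/dvdzP; exists (c * x); rewrite mulrAC -E; ring.
Qed.

Lemma dvdz_exp_inv (m s t : int) n : (m %| s * t - 1)%Z ->
  (m %| s ^+ n * t ^+ n - 1)%Z.
Proof.
by rewrite -exprMn -!eqz_mod_dvd => /eqP E; rewrite -modzXm E modzXm expr1n.
Qed.

Lemma eq_pm1_mod_inv (m : nat) (s t : int) :
  (m %| s * t - 1)%Z -> eq_pm1_mod m s -> eq_pm1_mod m t.
Proof.
rewrite /eq_pm1_mod !eqz_mod_dvd => /dvdzP[c E] /orP[] /dvdzP[b Eb]; apply/orP.
  left; apply/dvdzP; exists (c - b * t).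
  by rewrite mulrBl mulrAC -E -Eb; ring.
right; apply/dvdzP; exists (b * t - c).
by rewrite mulrBl mulrAC -E -Eb; ring.
Qed.

Lemma eq_Zp1_mulz_double (m : nat) (v : Zmod m) (E X : int) : odd m ->
  v *~ 2 = Zp1 *~ E -> (v == Zp1 *~ X) = (m %| E - 2 * X)%Z.
Proof.
move=> m_odd; have m_gt0 := odd_gt0 m_odd; rewrite -(Zp1_mulz_val v) -mulrzA.
move/eqP; rewrite !eq_Zp1_mulz // => dvE.
have cop : coprimez m 2 by rewrite coprimezE /= coprimen2.
rewrite -(Gauss_dvdzr _ cop); apply: eq_dvdz.
by move: dvE; congr (_ %| _)%Z; ring.
Qed.

Theorem theorem5p6 (m : nat) (m_odd : odd m)
    (r : nat) (W : (r.*2.+1).-tuple int)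
    (sigmaE : sigma W = - 2 * sigma' W)
    (sigma_inv : invertible_mod m (sigma W))
    (a d : Zmod m) (d_inv : Zmod_invertible d)
    (j : int * nat) (e : int * int) (s : nat)
    (e_orient : e = (-1, 1) \/ e = (1, -1))
    (s_gt0 : (0 < s)%N)
    (s_mod : (s%:Z = 0 %[mod lcmn (pord m (sigma W)) m])%Z \/
             (s%:Z = -1 %[mod lcmn (pord m (sigma W)) m])%Z)
    (fits : triangle_in_array j e s)
    (antisym : antisymmetric01 (aca_orbit W (AP a d)) j e s) :
  balanced (triangle (aca_orbit W (AP a d)) j e s).
Proof.
have m_gt0 := odd_gt0 m_odd.
have [sg_pm1 _] := pordP m_gt0 sigma_inv.
have [t /eqP] := sigma_inv; rewrite eqz_mod_dvd => st1.
have ts1 : (m %| t * sigma W - 1)%Z by rewrite mulrC.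
have [L Ls /andP[dL sgL]] : exists2 L, L \in [:: s; s.+1] &
    (m %| L)%N && eq_pm1_mod m (sigma W ^+ L).
  have [L Ls dL] : exists2 L, L \in [:: s; s.+1] &
      (lcmn (pord m (sigma W)) m %| L)%N.
    case: s_mod => /eqP; rewrite eqz_mod_dvd dvdzE => dL.
      by exists s; rewrite ?inE ?eqxx // -[s]/(`|s%:Z|%N) -[s%:Z]subr0.
    exists s.+1; rewrite ?inE ?eqxx ?orbT // -addn1.
    by move: dL; rewrite opprK.
  exists L => //; rewrite (dvdn_trans (dvdn_lcmr _ _) dL) /=.
  have /dvdnP[q ->] := dvdn_trans (dvdn_lcml _ _) dL.
  by rewrite mulnC exprM eq_pm1_modX.
have tL : eq_pm1_mod m (t ^+ L) := eq_pm1_mod_inv (dvdz_exp_inv L st1) sgL.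
have [D dD1] : exists D : int, (m %| d%:Z * D - 1)%Z.
  case: d_inv => y /(congr1 val) /= dy; exists y%:Z.
  rewrite -eqz_mod_dvd -PoszM !modz_nat; move: (d : nat) (y : nat) dy => d' y'.
  by rewrite prednK // => ->.
set sg := sigma W in st1 ts1 sgL *.
set O := aca_orbit W (AP a d) in antisym *.
have OE i n : O i n *~ 2 = Zp1 *~ (sg ^+ n * (2 * a%:Z + (2 * i - n%:Z) * d%:Z)).
  by rewrite -aca_orbit_AP // !Zp1_mulz_val.
clearbody sg O => {s_mod sg_pm1 sigma_inv sigmaE d_inv}.
have copE n : coprimez m (sg ^+ n * 2).
  rewrite coprimezMr [coprimez _ 2]coprimezE coprimen2 m_odd andbT.
  by rewrite coprimezXr // coprimez_sym (coprimez_inv st1).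
(* Antisymmetry is applied to the two ends of the first row only; the value it kills at the middle
   of that row is the same, up to a power of [sg], in every row. *)
have := antisym (0%N, 0%N) isT; rewrite /triangle_entry /= !subn0.
move/(congr1 (fun v => v *~ 2)); rewrite mul0rz mulrzDl !OE -mulrzDr => /eqP.
rewrite Zp1_mulz_eq0 //; case: e_orient fits => -> fits /=.
- rewrite addn0 => anti.
  pose B : int := 2 * a%:Z + (2 * j.1 - j.2%:Z - s.-1%:Z) * d%:Z.
  have {anti} dB : (m %| B)%Z.
    rewrite -(Gauss_dvdzr _ (copE j.2)); move: anti.
    by congr (is_true (_ %| _)%Z); rewrite /B; ring.
  (* The power of [t] is chosen so that, for a row of length [s - k2], the product
     [sg ^+ (s - k2) * t ^+ (j.2 + s)] is [t ^+ (j.2 + k2)], the inverse of the power of [sg] in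
     that row. *)
  apply: (@balanced_of_rows _ _ _ _ _ sg (2 * D * t ^+ (j.2 + s))) => //.
    exact: coprimez_inv st1.
    by exists L; rewrite ?dL.
  move=> X k1 k2 k_lt; have k2s : (k2 <= s)%N.
    exact: leq_trans (leq_addl _ _) (ltnW k_lt).
  rewrite (eq_Zp1_mulz_double _ m_odd (OE _ _)) /=.
  rewrite mul1n (dvdz_mul_inv _ _ (dvdz_exp_inv _ st1)).
  (* Subtracting [B] leaves the entry measured from the middle of its row. *)
  rewrite [LHS](@eq_dvdz _ _
      (d%:Z * (s.-1%:Z - k2%:Z - 2 * k1%:Z) - t ^+ (j.2 + k2) * (2 * X))).
    rewrite (dvdz_mul_inv _ _ dD1); apply: eq_dvdz.
    have /dvdzP[c Ec] := dvdz_exp_inv (s - k2) st1.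
    apply/dvdzP; exists (c * (2 * D * t ^+ (j.2 + k2) * X)).
    rewrite [RHS]mulrAC -Ec.
    have -> : (j.2 + s = j.2 + k2 + (s - k2))%N by rewrite -addnA subnKC.
    by rewrite -subzn // !exprD -subn1 -subzn //; ring.
  by move: dB; congr (is_true (_ %| _)%Z); rewrite /B; ring.
- rewrite addn0 => anti.
  pose B : int := 2 * a%:Z + (2 * j.1 - j.2%:Z + s.-1%:Z) * d%:Z.
  have {anti} dB : (m %| B)%Z.
    rewrite -(Gauss_dvdzr _ (copE j.2)); move: anti.
    by congr (is_true (_ %| _)%Z); rewrite /B; ring.
  (* Since the triangle fits in the array, the row index [j.2 - k2] is a true subtraction. *)
  have j_ge : (s.-1 <= j.2)%N.
    by have := fits (0%N, s.-1) (leqnn _); rewrite mulN1r subr_ge0.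
  (* Here longer rows come later in the orbit, so the unit is [t], inverse to [sg];
     [t ^+ (s - k2) * t ^+ j.2 * sg ^+ s] is [t ^+ (j.2 - k2)] modulo [m]. The sign reflects that
     entries now increase with [k1] in multiples of [d]. *)
  apply: (@balanced_of_rows _ _ _ _ _ t (- 2 * D * t ^+ j.2 * sg ^+ s)) => //.
    exact: coprimez_inv ts1.
    by exists L; rewrite ?dL.
  move=> X k1 k2 k_lt; have k2s : (k2 <= s)%N.
    exact: leq_trans (leq_addl _ _) (ltnW k_lt).
  rewrite (eq_Zp1_mulz_double _ m_odd (OE _ _)) /=.
  have k2j : (k2 <= j.2)%N.
    apply: leq_trans j_ge; rewrite -ltnS prednK //.
    exact: leq_ltn_trans (leq_addl _ _) k_lt.
  have -> : absz (j.2%:Z + -1 * k2%:Z) = (j.2 - k2)%N by rewrite mulN1r subzn.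
  rewrite (dvdz_mul_inv _ _ (dvdz_exp_inv _ st1)).
  rewrite [LHS](@eq_dvdz _ _
      (d%:Z * (2 * k1%:Z + k2%:Z - s.-1%:Z) - t ^+ (j.2 - k2) * (2 * X))).
    rewrite (dvdz_mul_inv _ _ dD1) -rpredN; apply: eq_dvdz.
    have /dvdzP[c Ec] := dvdz_exp_inv s st1.
    apply/dvdzP; exists (- c * (2 * D * t ^+ (j.2 - k2) * X)).
    rewrite [RHS]mulrAC [- c * _]mulNr -Ec.
    have -> : t ^+ j.2 = t ^+ (j.2 - k2) * t ^+ k2 by rewrite -exprD subnK.
    have -> : t ^+ s = t ^+ (s - k2) * t ^+ k2 by rewrite -exprD subnK.
    by rewrite -subzn // -subn1 -subzn //; ring.
  rewrite -subzn //.
  by move: dB; congr (is_true (_ %| _)%Z); rewrite /B; ring.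
Qed.
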